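(* For all integers $n\ge 24$ and $k\ge 2$, $$3k+1\le \pi_R(P_n[E_k])\le 3k+\lceil k/2\rceil .$$
   Context: $P_n$ is the path on $n$ vertices and $E_k$ is the empty (edgeless) graph on $k$ vertices. The lexicographic product $G[H]$ of graphs $G=(V_1,E_1)$ and $H=(V_2,E_2)$ has vertex set $V_1\times V_2$, and $(v_1,v_2)$ is joined to $(v_1',v_2')$ if either $(v_1,v_1')\in E_1$, or $v_1=v_1'$ and $(v_2,v_2')\in E_2$. For $v\in V_1$, the set $v[H]=\{(v,v_2):v_2\in V_2\}$ is called a layer of $G[H]$; it is rainbow colored if all its vertices receive distinct colors. A sequence $x_1\ldots x_{2l}$ ($l\ge 1$) is a repetition if $x_i=x_{l+i}$ for all $1\le i\le l$. A vertex coloring $c$ of a graph is nonrepetitive if there is no path $v_1,\ldots,v_{2l}$ in the graph (with distinct vertices, $l\ge1$) such that $c(v_1),\ldots,c(v_{2l})$ is a repetition. A rainbow nonrepetitive coloring of $G[H]$ is a nonrepetitive coloring of $G[H]$ in which all layers are rainbow colored. The rainbow Thue chromatic number $\pi_R(G[H])$ is the least number of colors in a rainbow nonrepetitive coloring of $G[H]$. *)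

(* Defs.v *)
From mathcomp Require Import all_boot.
From mathcomp Require Import boolp.

Set Implicit Arguments.
Unset Strict Implicit.
Unset Printing Implicit Defensive.

Record sgraph := SGraph {
  vertex :> finType;
  edge : rel vertex;
  edge_sym : symmetric edge;
  edge_irrefl : irreflexive edge
}.

Arguments edge {s}.

Definition path_edge (n : nat) : rel 'I_n :=
  [rel i j : 'I_n | (i.+1 == j :> nat) || (j.+1 == i :> nat)].

Lemma path_edge_sym n : symmetric (@path_edge n).
Proof. by move=> i j; exact: orbC. Qed.

Lemma path_edge_irrefl n : irreflexive (@path_edge n).
Proof. by move=> i; rewrite /path_edge /= orbb gtn_eqF. Qed.

Definition path_graph (n : nat) : sgraph :=
  SGraph (@path_edge_sym n) (@path_edge_irrefl n).

Definition empty_edge (k : nat) : rel 'I_k := [rel _ _ | false].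

Lemma empty_edge_sym k : symmetric (@empty_edge k).
Proof. by []. Qed.

Lemma empty_edge_irrefl k : irreflexive (@empty_edge k).
Proof. by []. Qed.

Definition empty_graph (k : nat) : sgraph :=
  SGraph (@empty_edge_sym k) (@empty_edge_irrefl k).

Section LexProduct.
Variables G H : sgraph.

Definition lex_edge : rel (G * H) :=
  [rel x y : G * H | edge x.1 y.1 || ((x.1 == y.1) && edge x.2 y.2)].

Lemma lex_edge_sym : symmetric lex_edge.
Proof.
by move=> x y; rewrite /lex_edge /= edge_sym (eq_sym x.1) (@edge_sym H x.2 y.2).
Qed.

Lemma lex_edge_irrefl : irreflexive lex_edge.
Proof. by move=> x; rewrite /lex_edge /= !edge_irrefl andbF. Qed.

Definition lex_product : sgraph := SGraph lex_edge_sym lex_edge_irrefl.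

Definition layer (v : G) : {set lex_product} := [set (v, w) | w : H].

End LexProduct.

Definition repetition (A : Type) (s : seq A) : Prop :=
  exists l : nat, [/\ 1 <= l, size s = l.*2 &
    forall i, i < l -> onth s i = onth s (l + i)].

(* The path v_1, ..., v_2l is the sequence p: consecutive vertices are adjacent
   ([sorted edge p]) and all vertices are distinct ([uniq p]). *)
Definition nonrepetitive (G : sgraph) (C : Type) (c : G -> C) : Prop :=
  forall p : seq G, sorted edge p -> uniq p -> ~ repetition (map c p).

Definition rainbow_nonrepetitive (G H : sgraph) (C : Type)
    (c : lex_product G H -> C) : Prop :=
  nonrepetitive c /\ forall v : G, {in layer H v &, injective c}.

Definition rainbow_colorable (G H : sgraph) (m : nat) : Prop :=
  exists c : lex_product G H -> 'I_m, rainbow_nonrepetitive c.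

Lemma rainbow_colorable_card (G H : sgraph) :
  rainbow_colorable G H #|lex_product G H|.
Proof.
exists enum_rank; split=> [p _ p_uniq|v]; last by move=> x y _ _ /enum_rank_inj.
have := p_uniq; rewrite -(map_inj_uniq enum_rank_inj) => s_uniq.
move=> [l [l_gt0 sz_s /(_ 0 l_gt0) eq_c]]; rewrite addn0 in eq_c.
have l0 : 0 = l.
  by apply: (onth_inj _ _ _ s_uniq _ eq_c); rewrite minn0 sz_s double_gt0.
by rewrite -l0 in l_gt0.
Qed.

Lemma ex_rainbow_colorable (G H : sgraph) :
  exists m, `[< rainbow_colorable G H m >].
Proof. by exists #|lex_product G H|; apply/asboolP/rainbow_colorable_card. Qed.

Definition rainbow_thue_number (G H : sgraph) : nat :=
  ex_minn (ex_rainbow_colorable G H).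

(* Main.v *)
Require Import Defs.
From mathcomp Require Import all_boot.
From mathcomp Require Import boolp zify.

(** A path in the product is a walk on the layers that picks a color in each
    layer it visits, with distinct vertices. In a repetition the vertices number
    [t] of the two halves have the same color; as layers are rainbow, they lie in
    two different layers with a common color. So the two halves of a repetition
    are two walks in step, always in layers whose color sets meet, such that the
    first walk ends next to the start of the second.

    Upper bound. Cut the colors into seven atoms, four of size [uphalf k] and
    three of size [k./2], and let every layer take its colors from two atoms.
    Every fourth layer is a marker and meets only other markers. The three layers
    between two markers are the side, the center and the side of a segment of one
    of four kinds, and for two different kinds the sides or the centers are
    disjoint ([side_center_separate]). Hence two walks in step pass markers at the
    same time and can only pass segments of the same kind together. The sequence
    of the kinds is a square-free word over four letters without factor [aba],
    built from the Thue-Morse word ([thue4_square_free],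
    [thue4_palindrome_free]). The absence of [aba] keeps the pair of segments on
    one line, parallel or mirrored, and square-freeness then keeps the two walks
    apart ([thue4_line_exists], [walk_separated]), so that they cannot be the
    halves of one path.

    Lower bound. With at most [3 * k] colors, three disjoint layers use up all of
    them. Short repetitions then show that layers at distance two are equal or
    disjoint, except close to the ends ([distance2_equal]); so the twenty
    layers 2 to 21 of the first twenty-four form a word over three classes of
    colors. As [k] is at least two, the second half of a path may turn round and
    come back with other colors through layers it has visited. This forbids, in
    addition to squares, the words read by such folded paths
    ([folded_square_free]). Up to renaming letters only two words of length twenty
    avoid a few of them ([unfolded_words18]); they are mirror images, and the two
    layers that follow, or precede, such a word complete a repetition
    ([last_word_stuck]). *)

Set Implicit Arguments.
Unset Strict Implicit.
Unset Printing Implicit Defensive.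

(** * Square-free words from the Thue-Morse word *)

(** The first argument is fuel; any value at least [n] gives the parity of the
    number of binary digits 1 of [n]. *)
Fixpoint thue_morse_rec (f n : nat) : bool :=
  if f is f'.+1 then odd n (+) thue_morse_rec f' n./2 else false.

Definition thue_morse (n : nat) : bool := thue_morse_rec n n.

Lemma thue_morse_rec_fuel f g n :
  n <= f -> n <= g -> thue_morse_rec f n = thue_morse_rec g n.
Proof.
have rec0 : forall h, thue_morse_rec h 0 = false by elim.
elim: f g n => [|f IHf] [|g] [|n] //= nf ng; rewrite ?rec0 //.
by congr (_ (+) _); apply: IHf; lia.
Qed.

Lemma thue_morseE n : thue_morse n = odd n (+) thue_morse n./2.
Proof.
case: n => [|n] //; rewrite {1}/thue_morse [LHS]/=; congr (_ (+) _).
by apply: thue_morse_rec_fuel; lia.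
Qed.

(** Two equal consecutive letters can only start at an odd position. A factor of
    odd period [l] contains such a pair, because letters that alternate [l] times
    do not come back to the first one, and the copy of the pair one period later
    starts at an even position. An even period is halved by keeping the letters
    at every other position. *)
Lemma thue_morse_overlap_free n l : 0 < l ->
  ~ (forall i, i <= l -> thue_morse (n + i) = thue_morse (n + i + l)).
Proof.
elim/ltn_ind: l n => l IHl n l_gt0 overlap.
have [l_odd|l_even] := boolP (odd l).
  have equal_pair_odd : forall m, thue_morse m = thue_morse m.+1 -> odd m.
    move=> m; rewrite (thue_morseE m) (thue_morseE m.+1) /= uphalf_half.
    by case: (odd m) => //=; rewrite add0n; case: (thue_morse _).
  have [/hasP[i]|no_pair] := boolP (has
      (fun i => thue_morse (n + i) == thue_morse (n + i).+1) (iota 0 l)).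
    rewrite mem_iota add0n => /andP[_ i_lt] /eqP pair_i.
    have odd_i := equal_pair_odd _ pair_i.
    have : odd (n + i + l).
      apply: equal_pair_odd; rewrite -overlap; last by lia.
      by rewrite pair_i -addnS overlap //; congr thue_morse; lia.
    by rewrite oddD odd_i l_odd.
  have alternating : forall i, i <= l ->
      thue_morse (n + i) = thue_morse n (+) odd i.
    elim=> [|i IHi] i_le; first by rewrite addn0 addbF.
    have /hasPn/(_ i) := no_pair.
    rewrite mem_iota add0n addnS => /(_ i_le)/=; rewrite IHi; last exact: ltnW.
    by case: (thue_morse n); case: (odd i); case: (thue_morse _).
  have := overlap 0 (leq0n l); rewrite addn0 (alternating l (leqnn l)) l_odd.
  by case: (thue_morse n).
have l_double : l = l./2.*2 by lia.
apply: (IHl l./2 _ n./2) => [||i i_le]; [lia | lia |].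
have halve : forall j,
    thue_morse (n + j.*2) = odd n (+) thue_morse (n./2 + j).
  move=> j; rewrite thue_morseE oddD odd_double addbF.
  by congr (_ (+) thue_morse _); lia.
have := overlap i.*2; rewrite {2}l_double -addnA -doubleD !halve addnA.
by move=> /(_ ltac:(lia)) /addbI.
Qed.

(** One plus the difference of consecutive Thue-Morse letters. A square here
    makes the difference between the Thue-Morse word and its shift constant over
    two periods; a nonzero constant would need three distinct bits, and the
    constant 0 is an overlap. *)
Definition ternary_thue (n : nat) : nat := thue_morse n.+1 + ~~ thue_morse n.

Lemma ternary_thue_square_free n l : 0 < l ->
  ~ (forall i, i < l -> ternary_thue (n + i) = ternary_thue (n + i + l)).
Proof.
move=> l_gt0 square; apply: (@thue_morse_overlap_free n l l_gt0).
have shift : forall i, i <= l ->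
    thue_morse (n + i + l) + thue_morse n
      = thue_morse (n + i) + thue_morse (n + l).
  elim=> [|i IHi] i_le; first by rewrite addn0 addnC.
  have := IHi (ltnW i_le); have := square i i_le.
  rewrite /ternary_thue addnS addSn.
  by do 6 case: (thue_morse _).
have : thue_morse n = thue_morse (n + l).
  have := shift l (leqnn l).
  by case: (thue_morse n); case: (thue_morse (n + l)); case: (thue_morse _).
move=> tm_eq i i_le; have := shift i i_le; rewrite tm_eq.
by do 3 case: (thue_morse _).
Qed.

Lemma ternary_thue_lt3 n : ternary_thue n < 3.
Proof. by rewrite /ternary_thue; do 2 case: (thue_morse _). Qed.

(** A fourth letter inserted after every second letter of the ternary word. Three
    consecutive letters contain one inserted letter, and the other two are
    consecutive in the ternary word, hence distinct: there is no factor [aba]. *)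
Definition thue4 (n : nat) : nat :=
  if n %% 3 == 2 then 3 else ternary_thue (2 * (n %/ 3) + n %% 3).

Lemma thue4_lt4 n : thue4 n < 4.
Proof.
rewrite /thue4; case: ifP => // _; apply: ltn_trans (ternary_thue_lt3 _) _.
by [].
Qed.

Lemma ternary_thue_adjacent n : ternary_thue n <> ternary_thue n.+1.
Proof.
move=> eq_v; apply: (@ternary_thue_square_free n 1) => // - [|//] _.
by rewrite addn0 addn1.
Qed.

Lemma thue4_adjacent n : thue4 n <> thue4 n.+1.
Proof.
rewrite /thue4; have := ternary_thue_lt3 (2 * (n %/ 3) + n %% 3).
have := ternary_thue_lt3 (2 * (n.+1 %/ 3) + n.+1 %% 3).
have := @ternary_thue_adjacent (2 * (n %/ 3) + n %% 3).
case: eqP; case: eqP => ? ?; try lia.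
have -> : 2 * (n.+1 %/ 3) + n.+1 %% 3 = (2 * (n %/ 3) + n %% 3).+1 by lia.
by [].
Qed.

Lemma thue4_palindrome_free n : thue4 n <> thue4 n.+2.
Proof.
rewrite /thue4; have := ternary_thue_lt3 (2 * (n %/ 3) + n %% 3).
have := ternary_thue_lt3 (2 * (n.+2 %/ 3) + n.+2 %% 3).
have := @ternary_thue_adjacent (2 * (n %/ 3) + n %% 3).
case: eqP; case: eqP => ? ?; try lia.
have -> : 2 * (n.+2 %/ 3) + n.+2 %% 3 = (2 * (n %/ 3) + n %% 3).+1 by lia.
by [].
Qed.

(** For a period of at least three, the inserted letter shows that the period is a
    multiple of three, and erasing the inserted letters leaves a ternary square. *)
Lemma thue4_square_free n l : 0 < l ->
  ~ (forall i, i < l -> thue4 (n + i) = thue4 (n + i + l)).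
Proof.
move=> l_gt0 square.
have [l_le2|l_gt2] := leqP l 2.
  have := square 0 l_gt0; rewrite addn0.
  have [->|->] : l = 1 \/ l = 2 by lia.
    by rewrite addn1; exact: thue4_adjacent.
  by rewrite addn2; exact: thue4_palindrome_free.
have l_mod3 : l %% 3 = 0.
  (* The first inserted letter at or after position [n]. *)
  have [i i_lt nth_sep] : exists2 i, i < l & (n + i) %% 3 = 2.
    by exists (2 - n %% 3); lia.
  have := square i i_lt; have := ternary_thue_lt3
    (2 * ((n + i + l) %/ 3) + (n + i + l) %% 3).
  by rewrite /thue4 nth_sep eqxx; case: eqP => ? ? ?; lia.
pose m := l %/ 3.
(* [s] is the index, in the ternary word, of the first letter kept in the square. *)
have [s s_lo s_hi] : exists2 s, n <= 3 * (s %/ 2) + s %% 2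
    & forall i, i < 2 * m -> 3 * ((s + i) %/ 2) + (s + i) %% 2 < n + l.
  by exists (2 * (n %/ 3) + n %% 3); rewrite /m; lia.
apply: (@ternary_thue_square_free s (2 * m)) => [|i i_lt]; first by lia.
have := square (3 * ((s + i) %/ 2) + (s + i) %% 2 - n).
have s_hi_i := s_hi i i_lt.
rewrite subnKC; last by lia.
move=> /(_ ltac:(lia)).
rewrite /thue4.
set k := s + i.
have -> : ((3 * (k %/ 2) + k %% 2) %% 3 == 2) = false by lia.
have -> : ((3 * (k %/ 2) + k %% 2 + l) %% 3 == 2) = false by lia.
have -> : 2 * ((3 * (k %/ 2) + k %% 2) %/ 3)
          + (3 * (k %/ 2) + k %% 2) %% 3 = k by lia.
have -> // : 2 * ((3 * (k %/ 2) + k %% 2 + l) %/ 3)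
          + (3 * (k %/ 2) + k %% 2 + l) %% 3 = k + 2 * m by rewrite /m; lia.
Qed.

(** * Layers made of two atoms *)

Definition adjacent (x y : nat) : bool := (x.+1 == y) || (y.+1 == x).

(** The four kinds of segments. For two distinct kinds either the sides or the
    centers are disjoint, and inside a kind the side and the center are disjoint.
    Every pair starts with a large atom (one of 0 to 3), so that it can hold [k]
    colors for odd [k] as well. *)
Definition side (a : nat) : seq nat :=
  nth [::] [:: [:: 0; 1]; [:: 0; 2]; [:: 1; 4]; [:: 2; 5]] a.

Definition center (a : nat) : seq nat :=
  nth [::] [:: [:: 2; 4]; [:: 1; 5]; [:: 0; 5]; [:: 0; 4]] a.

Definition marker : seq nat := [:: 3; 6].

(** The four layers [4 i], ..., [4 i + 3] carry a marker, then the side, the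
    center and again the side of the segment named by the letter [thue4 i]. *)
Definition atoms (x : nat) : seq nat :=
  if x %% 4 == 0 then marker
  else if x %% 4 == 2 then center (thue4 (x %/ 4)) else side (thue4 (x %/ 4)).

(** Necessary for two layers to have a color in common. *)
Definition meet (x y : nat) : bool := has (mem (atoms x)) (atoms y).

Lemma side_center_disjoint a : a < 4 -> ~~ has (mem (side a)) (center a).
Proof. by move: a; do 4 case=> //. Qed.

Lemma center_side_disjoint a : a < 4 -> ~~ has (mem (center a)) (side a).
Proof. by move: a; do 4 case=> //. Qed.

(** This is what makes a pair of segments with different letters impassable: two
    walks in step would have to meet both in the sides and in the centers. *)
Lemma side_center_separate a b : a < 4 -> b < 4 ->
  has (mem (side a)) (side b) -> has (mem (center a)) (center b) -> a = b.
Proof. by move: a b; do 4 case=> //; do 4 case=> //. Qed.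

Lemma marker_meet x y : meet x y -> (x %% 4 == 0) = (y %% 4 == 0).
Proof.
rewrite /meet /atoms.
have no_marker : forall a, a < 4 -> [&& ~~ has (mem marker) (side a),
    ~~ has (mem marker) (center a), ~~ has (mem (side a)) marker
    & ~~ has (mem (center a)) marker].
  by do 4 case=> //.
have /and4P[? ? ? ?] := no_marker _ (thue4_lt4 (x %/ 4)).
have /and4P[? ? ? ?] := no_marker _ (thue4_lt4 (y %/ 4)).
by do 2 case: (_ %% 4 == 0) => //; case: ifP => // _;
  do ?[move=> bad; exfalso; move: bad; apply/negP => //].
Qed.

Lemma meet_sym x y : meet x y = meet y x.
Proof.
by rewrite /meet; apply/hasP/hasP => -[a ? ?]; exists a.
Qed.

(** Two walks that step together from sides into centers are in segments with the
    same letter. *)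
Lemma meet_center p q p' q' : meet p q -> meet p' q' ->
    adjacent p p' -> adjacent q q' -> odd p -> odd q -> p' %% 4 = 2 ->
  q' %% 4 = 2 /\ thue4 (p' %/ 4) = thue4 (q' %/ 4).
Proof.
rewrite /adjacent => meet_pq meet_pq' adj_p adj_q odd_p odd_q p'_mod.
have := marker_meet meet_pq'; rewrite p'_mod => q'_mod.
have {}q'_mod : q' %% 4 = 2 by lia.
split=> //; apply: side_center_separate; rewrite ?thue4_lt4 //.
  move: meet_pq; rewrite /meet /atoms.
  have [-> ->] : p %% 4 == 0 = false /\ p %% 4 == 2 = false by lia.
  have [-> ->] : q %% 4 == 0 = false /\ q %% 4 == 2 = false by lia.
  by have [-> ->] : p %/ 4 = p' %/ 4 /\ q %/ 4 = q' %/ 4 by lia.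
by move: meet_pq'; rewrite /meet /atoms p'_mod q'_mod.
Qed.

(** Pairs of segments [(u, v)] with equal letters are passed one after the other,
    and [f] describes how the second segment moves with the first: it is [x + d]
    when both walks advance in the same direction and [s - x] when they face each
    other. [on_line f u0 u v] says that [(u, v)] can be reached from [u0] through
    pairs with equal letters only. *)
Definition on_line (f : nat -> nat) (u0 u v : nat) : Prop :=
  v = f u /\ forall x, minn u0 u <= x <= maxn u0 u ->
    thue4 x = thue4 (f x) /\ x < f x.

(** First, two walks that leave a pair on the line through equal letters
    stay on the line; second, the two sets of segments visited along the line are
    separated by at least one segment. *)
Definition thue4_line (f : nat -> nat) (u0 : nat) : Prop :=
  (forall u v u' v', on_line f u0 u v -> adjacent u u' -> adjacent v v' ->
     thue4 u' = thue4 v' -> v' = f u')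
  /\ (forall u v u' v', on_line f u0 u v -> on_line f u0 u' v' -> u + 2 <= v').

(** If one pair [(u, v)] could be left both in parallel and in opposite directions,
    one walk would see the same letter on both sides of a segment. *)
Lemma thue4_cross u v d d' e e' : adjacent u d -> adjacent v d' ->
    adjacent u e -> adjacent v e' -> thue4 d = thue4 d' -> thue4 e = thue4 e' ->
  (d == u.+1) = (d' == v.+1) -> (e == u.+1) = (e' == v.+1).
Proof.
rewrite /adjacent => ud vd' ue ve' eq_d eq_e diag.
have [//|anti] := eqVneq (e == u.+1) (e' == v.+1); exfalso.
have pal x y : x = y.+2 \/ y = x.+2 -> thue4 x <> thue4 y.
  case=> ->; first exact/nesym/thue4_palindrome_free.
  exact: thue4_palindrome_free.
have [de|d'e'] : d = e \/ d' = e' by lia.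
  by apply: (pal d' e'); [lia | rewrite -eq_d -eq_e de].
by apply: (pal d e); [lia | rewrite eq_d eq_e d'e'].
Qed.

(** The line through [(u0, v0)] is mirrored if some pair of opposite neighbors has
    equal letters, and parallel otherwise; [thue4_cross] fixes the direction from
    there on. On a mirrored line the segments [u < v] cannot come within distance
    two, since that would be a repeated letter or a factor [aba]; on a parallel
    line the shift [d] bounds the number of segments, by square-freeness. *)
Lemma thue4_line_exists u0 v0 : thue4 u0 = thue4 v0 -> u0 < v0 ->
  exists f, f u0 = v0 /\ thue4_line f u0.
Proof.
move=> eq0 lt0.
pose anti := exists d d', [/\ adjacent u0 d, adjacent v0 d',
  thue4 d = thue4 d' & (d == u0.+1) != (d' == v0.+1)].
have [[d [d' [ud vd' eq_d anti_d]]]|no_anti] := pselect anti.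
  (* The walks face each other: the indices of the two segments have a fixed sum. *)
  exists (fun x => u0 + v0 - x); split; first by lia.
  split=> [u v u' v' [v_def line] uu' vv' eq'|u v u' v' [_ line] [-> line']].
    have [eq_u lt_u] := line u ltac:(lia).
    suff : (u' == u.+1) != (v' == v.+1) by move: uu' vv'; rewrite /adjacent; lia.
    have [e [e' [ue ve' eq_e anti_e]]] : exists e e', [/\ adjacent u e,
        adjacent v e', thue4 e = thue4 e' & (e == u.+1) != (e' == v.+1)].
      have [u_lt|u_gt|u_eq] := ltngtP u u0.
      - exists u.+1, v.-1; have [eq_u1 lt_u1] := line u.+1 ltac:(lia).
        split; rewrite /adjacent; try lia.
        by rewrite eq_u1; congr thue4; lia.
      - exists u.-1, v.+1; have [eq_u1 lt_u1] := line u.-1 ltac:(lia).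
        split; rewrite /adjacent; try lia.
        by rewrite eq_u1; congr thue4; lia.
      - by exists d, d'; rewrite v_def u_eq addKn.
    apply: contra anti_e => /eqP diag; apply/eqP.
    exact: (thue4_cross uu' vv' ue ve' eq' eq_e diag).
  have [m_eq m_lt] : thue4 (maxn u u') = thue4 (u0 + v0 - maxn u u')
      /\ maxn u u' < u0 + v0 - maxn u u'.
    by case: (leqP u u') => ?; [apply: line' | apply: line]; lia.
  have : u0 + v0 - maxn u u' != (maxn u u').+1.
    by apply/eqP => m1; rewrite m1 in m_eq; exact: thue4_adjacent m_eq.
  have : u0 + v0 - maxn u u' != (maxn u u').+2.
    by apply/eqP => m1; rewrite m1 in m_eq; exact: thue4_palindrome_free m_eq.
  lia.
(* The walks are parallel: the indices of the two segments have a fixed difference. *)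
exists (fun x => x + (v0 - u0)); split; first by lia.
split=> [u v u' v' [v_def line] uu' vv' eq'|u v u' v' [_ line] [-> line']].
  suff : (u' == u.+1) = (v' == v.+1) by move: uu' vv'; rewrite /adjacent; lia.
  have [u_eq|u_neq] := eqVneq u u0.
    have [//|anti_d] := eqVneq (u' == u.+1) (v' == v.+1).
    case: no_anti; exists u', v'; move: v_def uu' vv' anti_d.
    by rewrite u_eq subnKC 1?ltnW // => ->.
  have [e [e' [ue ve' eq_e diag_e]]] : exists e e', [/\ adjacent u e,
      adjacent v e', thue4 e = thue4 e' & (e == u.+1) = (e' == v.+1)].
    have [u_lt|u_ge] := ltnP u u0.
      exists u.+1, v.+1; have [eq_u1 lt_u1] := line u.+1 ltac:(lia).
      split; rewrite /adjacent; try lia.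
      by rewrite eq_u1; congr thue4; lia.
    exists u.-1, v.-1; have [eq_u1 lt_u1] := line u.-1 ltac:(lia).
    split; rewrite /adjacent; try lia.
    by rewrite eq_u1; congr thue4; lia.
  exact: (thue4_cross ue ve' uu' vv' eq_e eq' diag_e).
have [//|short] := leqP (u + 2) (u' + (v0 - u0)).
have D_gt0 : 0 < v0 - u0 by lia.
case: (thue4_square_free (n := u') D_gt0) => i i_lt.
have [lo|hi] := leqP (minn u0 u') (u' + i); last by lia.
have [in_line|out] := leqP (u' + i) (maxn u0 u').
  by have [] := line' (u' + i) ltac:(lia).
by have [] := line (u' + i) ltac:(lia).
Qed.

(** The layers within distance three of the centers [4 u + 2] and [4 v + 2]: the
    two segments, the markers around them and one layer beyond each marker. *)
Definition near (u v p q : nat) : Prop :=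
  [/\ 4 * u <= p + 1, p <= 4 * u + 5, 4 * v <= q + 1 & q <= 4 * v + 5].

(** The neighborhood of a pair of segments is only left into the center of another
    segment, hence, by [meet_center], into a pair with equal letters. That pair
    is a neighbor in both coordinates because consecutive letters differ, so it
    is on the line. *)
Lemma near_line_step f u0 p q p' q' : thue4_line f u0 ->
    meet p q -> meet p' q' -> adjacent p p' -> adjacent q q' -> p' < q' ->
    odd p = odd q ->
    (exists u v, on_line f u0 u v /\ near u v p q) ->
  exists u v, on_line f u0 u v /\ near u v p' q'.
Proof.
move=> [line _] meet_pq meet_pq' adj_p adj_q lt' par [u [v [on_uv near_uv]]].
have [v_def run] := on_uv; have [eq_u lt_u] := run u ltac:(lia).
have [ok|leave] := boolP [&& 4 * u <= p' + 1, p' <= 4 * u + 5,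
    4 * v <= q' + 1 & q' <= 4 * v + 5].
  by exists u, v; split=> //; apply/and4P.
have [mod_p' mod_q' eq'] :
    [/\ p' %% 4 = 2, q' %% 4 = 2 & thue4 (p' %/ 4) = thue4 (q' %/ 4)].
  case: near_uv => ? ? ? ?; have adj_p1 := adj_p; have adj_q1 := adj_q.
  rewrite /adjacent in adj_p1 adj_q1.
  have odd_p : odd p by lia.
  have odd_q : odd q by lia.
  have [p'2|q'2] : p' %% 4 = 2 \/ q' %% 4 = 2 by lia.
    by have [] := meet_center meet_pq meet_pq' adj_p adj_q odd_p odd_q p'2.
  rewrite meet_sym in meet_pq; rewrite meet_sym in meet_pq'.
  by have [? /esym] := meet_center meet_pq meet_pq' adj_q adj_p odd_q odd_p q'2.
have U_neq : p' %/ 4 <> u.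
  move=> U; rewrite U eq_u -v_def in eq'.
  have [V|V] : q' %/ 4 = v.+1 \/ v = (q' %/ 4).+1.
  - by case: near_uv => ? ? ? ?; rewrite /adjacent in adj_p adj_q; lia.
  - by rewrite V in eq'; exact: thue4_adjacent eq'.
  - by rewrite V in eq'; exact: thue4_adjacent (esym eq').
have V_neq : q' %/ 4 <> v.
  move=> V; rewrite V v_def -eq_u in eq'.
  have [U|U] : p' %/ 4 = u.+1 \/ u = (p' %/ 4).+1.
  - by case: near_uv => ? ? ? ?; rewrite /adjacent in adj_p adj_q; lia.
  - by rewrite U in eq'; exact: thue4_adjacent (esym eq').
  - by rewrite U in eq'; exact: thue4_adjacent eq'.
have adj_u : adjacent u (p' %/ 4).
  by case: near_uv => ? ? ? ?; rewrite /adjacent in adj_p adj_q *; lia.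
have adj_v : adjacent v (q' %/ 4).
  by case: near_uv => ? ? ? ?; rewrite /adjacent in adj_p adj_q *; lia.
have V_def := line _ _ _ _ on_uv adj_u adj_v eq'.
exists (p' %/ 4), (q' %/ 4); split; last first.
  by move: mod_p' mod_q'; clear; split; lia.
split=> // x x_in; have [->|x_neq] := eqVneq x (p' %/ 4).
  rewrite -V_def; split=> //.
  by move: lt' mod_p' mod_q'; clear; lia.
apply: run; move: adj_u x_in x_neq; rewrite /adjacent; clear.
by move: (p' %/ 4) => U; lia.
Qed.

(** * Two walks in step *)

Lemma constant_along (T : Type) (g : nat -> T) l :
  (forall t, t.+1 < l -> g t.+1 = g t) -> forall t, t < l -> g t = g 0.
Proof.
by move=> gS; elim=> // t IHt t_lt; rewrite gS // IHt // ltnW.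
Qed.

Lemma meet_same_segment x y : x %/ 4 = y %/ 4 -> odd x != odd y ->
  x %% 4 != 0 -> y %% 4 != 0 -> ~~ meet x y.
Proof.
move=> seg par x_n0 y_n0; rewrite /meet /atoms (negPf x_n0) (negPf y_n0) -seg.
have [x_even|x_odd] := eqVneq (x %% 4) 2.
  have -> : (y %% 4 == 2) = false by lia.
  exact/center_side_disjoint/thue4_lt4.
have -> : y %% 4 == 2 by lia.
exact/side_center_disjoint/thue4_lt4.
Qed.

Lemma near_marker x : x %% 4 != 2 ->
  4 * (x.+1 %/ 4) <= x.+1 <= 4 * (x.+1 %/ 4) + 2.
Proof. lia. Qed.

Section DoubleWalk.

Variables (p q : nat -> nat) (l : nat).
Hypothesis p_walk : forall t, t.+1 < l -> adjacent (p t) (p t.+1).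
Hypothesis q_walk : forall t, t.+1 < l -> adjacent (q t) (q t.+1).
Hypothesis pq_meet : forall t, t < l -> meet (p t) (q t).
Hypothesis pq_neq : forall t, t < l -> p t <> q t.
Hypothesis pq0 : p 0 < q 0.

Lemma walk_parity t : t < l -> odd (p t) (+) odd (q t) = odd (p 0) (+) odd (q 0).
Proof.
apply: (constant_along (g := fun t => odd (p t) (+) odd (q t))) => {}t t_lt.
by have := p_walk t_lt; have := q_walk t_lt; rewrite /adjacent; lia.
Qed.

(** At odd distance the walks never reach a marker, since marker layers only meet
    marker layers. So each of them stays in one segment. *)
Lemma odd_walk_separated s t : odd (p 0) != odd (q 0) -> s < l -> t < l ->
  p s + 2 <= q t.
Proof.
move=> par s_lt t_lt.
have no_marker : forall i, i < l -> p i %% 4 != 0 /\ q i %% 4 != 0.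
  move=> i i_lt; have := walk_parity i_lt; have := marker_meet (pq_meet i_lt).
  lia.
have p_seg : p s %/ 4 = p 0 %/ 4.
  apply: (constant_along (g := fun i => p i %/ 4)) s_lt => i i_lt.
  have [? _] := no_marker _ i_lt; have [? _] := no_marker _ (ltnW i_lt).
  by have := p_walk i_lt; rewrite /adjacent; lia.
have q_seg : q t %/ 4 = q 0 %/ 4.
  apply: (constant_along (g := fun i => q i %/ 4)) t_lt => i i_lt.
  have [_ ?] := no_marker _ i_lt; have [_ ?] := no_marker _ (ltnW i_lt).
  by have := q_walk i_lt; rewrite /adjacent; lia.
have l_gt0 : 0 < l by lia.
have [p0 q0] := no_marker 0 l_gt0.
have [_ qt] := no_marker t t_lt; have [ps _] := no_marker s s_lt.
have [seg|seg] := eqVneq (p 0 %/ 4) (q 0 %/ 4); last by lia.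
by have := meet_same_segment seg par p0 q0; rewrite pq_meet.
Qed.

Lemma even_walk_ordered t : odd (p 0) = odd (q 0) -> t < l -> p t < q t.
Proof.
move=> par; elim: t => // t IHt t_lt; have {}IHt := IHt (ltnW t_lt).
have := p_walk t_lt; have := q_walk t_lt; have := pq_neq t_lt.
have := walk_parity (ltnW t_lt); rewrite /adjacent; lia.
Qed.

(** A walk that avoids centers stays within distance one of a marker. Otherwise,
    if there is a step at all, both walks visit the centers of two segments with
    equal letters at the same time, and they stay near the line of that pair. *)
Lemma even_walk_separated s t : odd (p 0) = odd (q 0) -> s < l -> t < l ->
  p s + 2 <= q t.
Proof.
move=> par s_lt t_lt.
have par_t : forall i, i < l -> odd (p i) = odd (q i).
  by move=> i /walk_parity; lia.
have lt_t : forall i, i < l -> p i < q i.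
  by move=> i; exact: even_walk_ordered.
have [l_le1|l_gt1] := leqP l 1.
  have [-> ->] : s = 0 /\ t = 0 by lia.
  by lia.
have [/hasP[t0]|no_center] := boolP (has (fun i => p i %% 4 == 2) (iota 0 l)).
  rewrite mem_iota add0n => /andP[_ t0_lt] /eqP p_center.
  have [t1 [t1_lt adj_p adj_q]] : exists t1, [/\ t1 < l,
      adjacent (p t1) (p t0) & adjacent (q t1) (q t0)].
    have [t0S|t0_last] := ltnP t0.+1 l.
      exists t0.+1; split=> //; rewrite /adjacent orbC;
        [exact: p_walk | exact: q_walk].
    have t0_pred : t0.-1.+1 = t0 by lia.
    exists t0.-1; rewrite -{3 5}t0_pred.
    by split; [lia | apply: p_walk; lia | apply: q_walk; lia].
  have [] := meet_center (pq_meet t1_lt) (pq_meet t0_lt) adj_p adj_q _ _ p_center.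
  - by rewrite /adjacent in adj_p; lia.
  - by have := par_t _ t1_lt; rewrite /adjacent in adj_p; lia.
  move=> q_center eq_letter.
  have [|f [f0 f_line]] := thue4_line_exists eq_letter.
    by have := lt_t _ t0_lt; lia.
  pose close i := exists u v,
    on_line f (p t0 %/ 4) u v /\ near u v (p i) (q i).
  have close0 : close t0.
    exists (p t0 %/ 4), (q t0 %/ 4); split; last first.
      by move: p_center q_center; clear; split; lia.
    split=> // x; rewrite minnn maxnn => x_in; have -> : x = p t0 %/ 4 by lia.
    by rewrite f0; split=> //; have := lt_t _ t0_lt; lia.
  have closeS : forall i, i.+1 < l -> (close i.+1 : Prop) = close i.
    move=> i i_lt; have i_lt' := ltnW i_lt; apply/propext; split.
      apply: (near_line_step f_line (pq_meet i_lt) (pq_meet i_lt')).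
      - by rewrite /adjacent orbC; exact: p_walk.
      - by rewrite /adjacent orbC; exact: q_walk.
      - exact: lt_t.
      - exact: par_t.
    exact: (near_line_step f_line (pq_meet i_lt') (pq_meet i_lt)
              (p_walk i_lt) (q_walk i_lt) (lt_t _ i_lt) (par_t _ i_lt')).
  have close_all : forall i, i < l -> close i.
    by move=> i i_lt; rewrite (constant_along closeS i_lt)
      -(constant_along closeS t0_lt).
  have [u [v [uv [_ ps _ _]]]] := close_all s s_lt.
  have [u' [v' [uv' [_ _ qt _]]]] := close_all t t_lt.
  by have := f_line.2 _ _ _ _ uv uv'; lia.
have p_center : forall i, i < l -> p i %% 4 != 2.
  by move=> i i_lt; move/hasPn: no_center; apply; rewrite mem_iota.
have q_center : forall i, i < l -> q i %% 4 != 2.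
  move=> i i_lt; have := p_center i i_lt; have := par_t i i_lt.
  have := marker_meet (pq_meet i_lt); lia.
(* Without centers, [(p i).+1 %/ 4] is the index of the marker next to [p i]. *)
have p_near : forall i, i < l -> (p i).+1 %/ 4 = (p 0).+1 %/ 4.
  apply: (constant_along (g := fun i => (p i).+1 %/ 4)) => i i_lt.
  have := p_center _ i_lt; have := p_center _ (ltnW i_lt).
  by have := p_walk i_lt; rewrite /adjacent; lia.
have q_near : forall i, i < l -> (q i).+1 %/ 4 = (q 0).+1 %/ 4.
  apply: (constant_along (g := fun i => (q i).+1 %/ 4)) => i i_lt.
  have := q_center _ i_lt; have := q_center _ (ltnW i_lt).
  by have := q_walk i_lt; rewrite /adjacent; lia.
have near_s := near_marker (p_center s s_lt).
have near_t := near_marker (q_center t t_lt).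
have near_p0 := near_marker (p_center 0 (ltnW l_gt1)).
have near_q0 := near_marker (q_center 0 (ltnW l_gt1)).
have near_p1 := near_marker (p_center 1 l_gt1).
have near_q1 := near_marker (q_center 1 l_gt1).
rewrite p_near // in near_s; rewrite p_near // in near_p1.
rewrite q_near // in near_t; rewrite q_near // in near_q1.
have [seg|seg] := eqVneq ((p 0).+1 %/ 4) ((q 0).+1 %/ 4); last first.
  move: near_s near_t near_p0 near_q0 pq0 seg; clear.
  by move: (_ %/ 4) (_ %/ 4) => c d; lia.
(* Near the same marker, two distinct odd layers lie on both sides of it, and
   there is only one even layer for the next step. *)
have lt1 := lt_t 1 l_gt1; have par1 := par_t 1 l_gt1; have := p_walk l_gt1.
rewrite -seg in near_q0 near_q1; rewrite /adjacent.
move: near_p0 near_q0 near_p1 near_q1 pq0 par lt1 par1; clear.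
by move: (_ %/ 4) => c; lia.
Qed.

(** In particular [p l.-1] and [q 0] are never adjacent layers, which is what a
    repetition would need in its middle. *)
Lemma walk_separated s t : s < l -> t < l -> p s + 2 <= q t.
Proof.
have [|] := eqVneq (odd (p 0)) (odd (q 0)).
  exact: even_walk_separated.
exact: odd_walk_separated.
Qed.

End DoubleWalk.

(** * The coloring with 3k + ceil(k/2) colors *)

Lemma lex_path_edge n k (x y : lex_product (path_graph n) (empty_graph k)) :
  edge x y = adjacent x.1 y.1.
Proof.
by rewrite -[edge x y]/(lex_edge x y) /lex_edge /= andbF orbF.
Qed.

Section Coloring.

Variables n k : nat.

(** The atoms are consecutive intervals of colors: the first four have
    [uphalf k] elements and the others have [k./2]. *)
Definition atom_start (a : nat) : nat := a * k./2 + minn a 4 * odd k.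

Definition vertex_atom (x j : nat) : nat := nth 0 (atoms x) (uphalf k <= j).

(** The first [uphalf k] vertices of a layer fill its first atom; the remaining
    [k./2] vertices take the first colors of its second atom. *)
Definition vertex_color (x j : nat) : nat :=
  atom_start (vertex_atom x j) + (j - (uphalf k <= j) * uphalf k).

Lemma atoms_lt x : [/\ nth 0 (atoms x) 0 < 4, nth 0 (atoms x) 1 < 7,
  nth 0 (atoms x) 0 != nth 0 (atoms x) 1 & size (atoms x) = 2].
Proof.
rewrite /atoms; have := thue4_lt4 (x %/ 4); move: (thue4 (x %/ 4)) => a.
by case: eqP => // _; case: eqP => _; move: a; do 4 case=> //.
Qed.

Lemma vertex_atom_mem x j : vertex_atom x j \in atoms x.
Proof.
have [_ _ _ sz] := atoms_lt x.
by apply: mem_nth; rewrite sz; case: (uphalf k <= j).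
Qed.

Lemma atom_start_le a b : a < b ->
  atom_start a + k./2 + (a < 4) * odd k <= atom_start b.
Proof.
rewrite /atom_start => lt_ab; have := leq_mul lt_ab (leqnn k./2).
rewrite mulSn; case: (odd k); lia.
Qed.

Lemma vertex_offset_lt x j : j < k -> j - (uphalf k <= j) * uphalf k
  < k./2 + (vertex_atom x j < 4) * odd k.
Proof.
rewrite /vertex_atom; have [small _ _ _] := atoms_lt x.
have := odd_double_half k; have := uphalf_half k.
by case: (odd k); case: (leqP (uphalf k) j) => /= ? ? ? ?; rewrite ?small; lia.
Qed.

Lemma vertex_color_lt x j : j < k -> vertex_color x j < 3 * k + uphalf k.
Proof.
move=> j_lt; have := vertex_offset_lt x j_lt.
have atom_lt : vertex_atom x j < 7.
  rewrite /vertex_atom; have [small big _ _] := atoms_lt x.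
  by case: (uphalf k <= j) => //; apply: ltn_trans small _.
have := atom_start_le atom_lt; rewrite /vertex_color.
have := odd_double_half k; have := uphalf_half k.
have -> : atom_start 7 = 7 * k./2 + 4 * odd k by [].
lia.
Qed.

(** Distinct atoms are disjoint, and the two atoms of a layer are distinct. *)
Lemma vertex_color_inj x y i j : i < k -> j < k ->
  vertex_color x i = vertex_color y j ->
  vertex_atom x i = vertex_atom y j /\ (x = y -> i = j).
Proof.
move=> i_lt j_lt; have := vertex_offset_lt x i_lt.
have := vertex_offset_lt y j_lt.
rewrite /vertex_color => rj ri eq_c.
have same_atom : vertex_atom x i = vertex_atom y j.
  case: (ltngtP (vertex_atom x i) (vertex_atom y j)) => // /atom_start_le; lia.
split=> // eq_xy; move: same_atom eq_c; rewrite eq_xy => same_atom.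
rewrite same_atom => /addnI; move: same_atom; rewrite /vertex_atom.
have [_ _ /eqP ab _] := atoms_lt y.
by case: (leqP (uphalf k) i); case: (leqP (uphalf k) j) => /=; lia.
Qed.

Lemma rainbow_coloring :
  rainbow_colorable (path_graph n) (empty_graph k) (3 * k + uphalf k).
Proof.
pose c (v : lex_product (path_graph n) (empty_graph k)) :=
  Ordinal (vertex_color_lt v.1 (ltn_ord v.2)).
have c_inj u v : c u = c v -> vertex_atom u.1 u.2 = vertex_atom v.1 v.2
    /\ (u.1 = v.1 :> nat -> u = v).
  move=> /(congr1 val) /= /vertex_color_inj [] // same_atom inj.
  split=> // eq1; have eq2 := inj eq1.
  by apply/eqP; rewrite -pair_eqE /pair_eq; apply/andP; split; apply/eqP/val_inj.
exists c; split; last first.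
  move=> v _ _ /imsetP[i _ ->] /imsetP[j _ ->] /c_inj[_]; exact.
move=> p p_path p_uniq [l [l_gt0 size_cp rep]].
rewrite size_map in size_cp.
have [v0 _] : exists v0 : lex_product (path_graph n) (empty_graph k), true.
  by case: (p) size_cp => [/=|v0 ?]; [lia | exists v0].
pose pos t : nat := (nth v0 p t).1.
have walk t : t.+1 < l.*2 -> adjacent (pos t) (pos t.+1).
  rewrite -size_cp => t_lt; rewrite -lex_path_edge.
  by move/(sortedP v0): p_path; apply.
have same t : t < l -> meet (pos t) (pos (l + t)) /\ pos t <> pos (l + t).
  move=> t_lt; have := rep t t_lt.
  rewrite !onthE -!map_comp !(nth_map v0) ?size_cp; [|lia|lia].
  move=> /Some_inj /c_inj[same_atom eq_v]; split.
    rewrite meet_sym; apply/hasP; exists (vertex_atom (pos t) (nth v0 p t).2).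
      exact: vertex_atom_mem.
    by rewrite /= same_atom vertex_atom_mem.
  move=> /eq_v/eqP; rewrite nth_uniq ?size_cp //; lia.
have step1 t : t.+1 < l -> adjacent (pos t) (pos t.+1).
  by move=> t_lt; apply: walk; lia.
have step2 t : t.+1 < l -> adjacent (pos (l + t)) (pos (l + t.+1)).
  by move=> t_lt; rewrite addnS; apply: walk; lia.
have middle : adjacent (pos l.-1) (pos (l + 0)).
  by rewrite addn0 -{2}(prednK l_gt0); apply: walk; lia.
have [_ neq0] := same 0 l_gt0; rewrite /adjacent in middle.
have [lt0|gt0|//] := ltngtP (pos 0) (pos (l + 0)).
  have := @walk_separated pos (fun t => pos (l + t)) l step1 step2
    (fun t t_lt => (same t t_lt).1) (fun t t_lt => (same t t_lt).2) lt0
    l.-1 0 ltac:(lia) l_gt0; lia.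
have := @walk_separated (fun t => pos (l + t)) pos l step2 step1
  (fun t t_lt => etrans (meet_sym _ _) (same t t_lt).1)
  (fun t t_lt => nesym (same t t_lt).2) gt0 0 l.-1 l_gt0 ltac:(lia); lia.
Qed.

End Coloring.

(** * Repetitions in a short sequence of layers *)

(** Nonrepetitiveness in terms of the color sets [S i] of the first [N] layers: a
    vertex is given by its layer and its color. *)
Definition repetition_free_layers (N : nat) (T : finType) (S : nat -> {set T}) :=
  forall l (pos : nat -> nat) (col : nat -> T), 0 < l ->
    (forall t, t < l.*2 -> pos t < N /\ col t \in S (pos t)) ->
    (forall t, t.+1 < l.*2 -> adjacent (pos t) (pos t.+1)) ->
    (forall s t, s < l.*2 -> t < l.*2 ->
       pos s = pos t -> col s = col t -> s = t) ->
    (forall t, t < l -> col t = col (l + t)) -> False.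

(** The walk [0, 1, ..., m - 1, m - 2, ...] that turns round at [m - 1]. *)
Definition fold_back (m t : nat) : nat := if t < m then t else 2 * m.-1 - t.

Section ShortRepetitions.

Variables (T : finType) (N : nat) (S : nat -> {set T}).
Hypothesis S_free : repetition_free_layers N S.

(** The first half of the path goes straight through [l] layers and the second
    half turns round in the next [m] layers. The last hypothesis keeps its
    vertices distinct where a layer is visited twice. *)
Lemma folded_square_free e l m (f : nat -> T) :
    0 < m -> m <= l -> l < m.*2 -> e + l + m <= N ->
    (forall t, t < l -> f t \in S (e + t)) ->
    (forall t, t < l -> f t \in S (e + l + fold_back m t)) ->
    (forall s t, s < m -> m <= t < l -> fold_back m t = s -> f s <> f t) ->
  False.
Proof.
move=> m_gt0 ml lm eN f1 f2 f_neq.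
apply: (@S_free l (fun t => if t < l then e + t else e + l + fold_back m (t - l))
                  (fun t => f (if t < l then t else t - l))).
- exact: leq_trans m_gt0 ml.
- move=> t t_lt; case: (ltnP t l) => t_l; split; try exact: f1.
  + by lia.
  + by rewrite /fold_back; case: (ltnP (t - l) m); lia.
  + by apply: f2; lia.
- move=> t t_lt; rewrite /adjacent /fold_back.
  case: (ltnP t l); case: (ltnP t.+1 l); case: (ltnP (t - l) m);
    by case: (ltnP (t.+1 - l) m); lia.
- move=> s t s_lt t_lt; case: (ltnP s l) => s_l; case: (ltnP t l) => t_l.
  + by lia.
  + by lia.
  + by lia.
  have [s_m|s_m] := ltnP (s - l) m; have [t_m|t_m] := ltnP (t - l) m.
  + by rewrite /fold_back s_m t_m; lia.
  + move=> eq_pos eq_col; case: (f_neq (s - l) (t - l)) => //; first by lia.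
    by move: eq_pos; rewrite /fold_back s_m; lia.
  + move=> eq_pos eq_col; case: (f_neq (t - l) (s - l)) => //; first by lia.
    by move: eq_pos; rewrite /fold_back t_m; lia.
  + by rewrite /fold_back (ltnNge _ m) s_m (ltnNge _ m) t_m /=; lia.
- move=> t t_lt; rewrite t_lt; case: (ltnP (l + t) l); first by lia.
  by rewrite addKn.
Qed.

Lemma square_free_layers e l (f : nat -> T) : 0 < l -> e + l.*2 <= N ->
    (forall t, t < l -> f t \in S (e + t)) ->
    (forall t, t < l -> f t \in S (e + l + t)) ->
  False.
Proof.
move=> l_gt0 eN f1 f2.
apply: (@folded_square_free e l l f) => //; try lia.
by move=> t t_lt; rewrite /fold_back t_lt f2.
Qed.

Lemma adjacent_disjoint i x : i.+1 < N -> x \in S i -> x \in S i.+1 -> False.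
Proof.
move=> i_lt x0 x1; apply: (@square_free_layers i 1 (fun=> x)) => //; first lia.
  by move=> [|t] // _; rewrite addn0.
by move=> [|t] // _; rewrite addn0 addn1.
Qed.

Lemma meet2_alternate i x y : i.+3 < N -> x \in S i -> x \in S i.+2 ->
  y \in S i.+1 -> y \in S i.+3 -> False.
Proof.
move=> i_lt x0 x2 y1 y3.
apply: (@square_free_layers i 2 (nth x [:: x; y])) => //; first lia.
  by move=> [|[|t]] // _; rewrite ?addn0 ?addn1.
by move=> [|[|t]] // _; rewrite addn2 ?addn0 ?addn1.
Qed.

Lemma adjacent_layers i : i.+1 < N -> [disjoint S i & S i.+1].
Proof.
move=> i_lt; rewrite disjoint_subset; apply/subsetP => x x0.
by apply/negP => x1; exact: adjacent_disjoint i_lt x0 x1.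
Qed.

Lemma alternate_layers i x : i.+3 < N -> x \in S i -> x \in S i.+2 ->
  [disjoint S i.+1 & S i.+3].
Proof.
move=> i_lt x0 x2; rewrite disjoint_subset; apply/subsetP => y y1.
by apply/negP => y3; exact: meet2_alternate i_lt x0 x2 y1 y3.
Qed.

End ShortRepetitions.

Lemma exists_diff (T : finType) (A B : {set T}) : #|A| = #|B| -> A <> B ->
  exists2 x, x \in A & x \notin B.
Proof.
move=> card_AB neq; apply/subsetPn/negP => sub; apply: neq.
by apply/eqP; rewrite eqEcard sub card_AB leqnn.
Qed.

Section ThreeLayers.

Variables (T : finType) (k : nat).
Hypothesis T_card : #|T| <= 3 * k.

(** Three disjoint layers use up all colors. *)
Lemma third_layer (A B C : {set T}) x : #|A| = k -> #|B| = k -> #|C| = k ->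
    [disjoint A & B] -> [disjoint B & C] -> [disjoint A & C] ->
  x \notin A -> x \notin B -> x \in C.
Proof.
move=> cA cB cC AB BC AC xA xB.
have : A :|: B :|: C = [set: T].
  apply/eqP; rewrite eqEcard subsetT cardsT.
  have /eqP -> : #|A :|: B :|: C| == #|A :|: B| + #|C|.
    by rewrite (leq_card_setU _ _).2 disjoints_subset subUset -!disjoints_subset AC.
  have /eqP -> : #|A :|: B| == #|A| + #|B| by rewrite (leq_card_setU _ _).2.
  by rewrite cA cB cC; apply: leq_trans T_card _; lia.
by move/setP/(_ x); rewrite !inE (negPf xA) (negPf xB).
Qed.

Lemma third_layer_eq (A B C D : {set T}) :
    #|A| = k -> #|B| = k -> #|C| = k -> #|D| = k ->
    [disjoint A & B] -> [disjoint B & C] -> [disjoint A & C] ->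
    [disjoint A & D] -> [disjoint B & D] ->
  D = C.
Proof.
move=> cA cB cC cD AB BC AC AD BD.
apply/eqP; rewrite eqEcard cC cD leqnn andbT; apply/subsetP => x xD.
by apply: third_layer cA cB cC AB BC AC _ _;
  rewrite ?(disjointFl AD xD) ?(disjointFl BD xD).
Qed.

End ThreeLayers.

(** Number the eight layers from 0 and suppose that layers 2 and 4 share [x] but
    differ. Three disjoint consecutive layers use up all colors, so there are [y]
    in layers 2 and 5, [z] in layers 4 and 1, and [w] in layers 5 and 1. Without
    the repetitions [z y b z y b] and [b z y b z y], layer 6 has to be layer 4,
    layer 0 has to be layer 2 and layer 7 layer 3, and the eight layers carry
    the repetition [x w x b x w x b]. *)
Lemma distance2_equal (T : finType) (N k : nat) (S : nat -> {set T}) i x :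
    repetition_free_layers N S -> #|T| <= 3 * k ->
    (forall j, j < N -> #|S j| = k) -> 1 < k -> i + 7 < N -> 
    x \in S (i + 2) -> x \in S (i + 4) ->
  S (i + 2) = S (i + 4).
Proof.
move=> S_free T_card S_card k_gt1 i_lt x2 x4; apply: contrapT => neq.
have card j : j < 8 -> #|S (i + j)| = k by move=> ?; apply: S_card; lia.
have adj j : j < 7 -> [disjoint S (i + j) & S (i + j.+1)].
  by move=> ?; rewrite addnS; apply: (adjacent_layers S_free); lia.
have alt j y : j < 5 -> y \in S (i + j) -> y \in S (i + j.+2) ->
    [disjoint S (i + j.+1) & S (i + j.+3)].
  by move=> ?; rewrite !addnS; apply: (alternate_layers S_free); lia.
have square j l (s : seq T) : 0 < l -> j + l.*2 <= 8 ->
    (forall t, t < l -> nth x s t \in S (i + (j + t))) ->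
    (forall t, t < l -> nth x s t \in S (i + (j + l + t))) -> False.
  move=> l_gt0 l_le s1 s2.
  by apply: (square_free_layers S_free (e := i + j) (l := l) (f := nth x s)) => //;
    first lia;
    move=> t t_lt; rewrite -!addnA ?s1 // !addnA -[i + j + l]addnA -addnA s2.
have d13 : [disjoint S (i + 1) & S (i + 3)].
  rewrite disjoint_sym disjoint_subset; apply/subsetP => y y3; apply/negP => y1.
  by rewrite (disjointFr (alt 1 y _ y1 y3) x2) in x4.
have d35 := alt 2 x isT x2 x4.
have in5 y : y \notin S (i + 3) -> y \notin S (i + 4) -> y \in S (i + 5).
  exact: (third_layer T_card (card 3 _) (card 4 _) (card 5 _) (adj 3 _) (adj 4 _) d35).
have in1 y : y \notin S (i + 3) -> y \notin S (i + 2) -> y \in S (i + 1).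
  by apply: (third_layer T_card); rewrite ?card // disjoint_sym ?adj.
have [y y2 y4] := exists_diff (etrans (card 2 isT) (esym (card 4 isT))) neq.
have [z z4 z2] := exists_diff (etrans (card 4 isT) (esym (card 2 isT))) (nesym neq).
have y5 : y \in S (i + 5) by apply: in5; rewrite ?(disjointFr (adj 2 _) y2).
have z1 : z \in S (i + 1) by apply: in1; rewrite ?(disjointFl (adj 3 _) z4).
have x5 := disjointFr (adj 4 isT) x4.
have [w w5 w2] : exists2 w, w \in S (i + 5) & w \notin S (i + 2).
  apply: exists_diff; first by rewrite !card.
  by move=> eq52; rewrite eq52 x2 in x5.
have w1 : w \in S (i + 1) by apply: in1; rewrite ?(disjointFl d35 w5).
have d36 : [disjoint S (i + 3) & S (i + 6)].
  rewrite disjoint_subset; apply/subsetP => b b3; apply/negP => b6.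
  by apply: (@square 1 3 [:: z; y; b]) => //; move=> [|[|[|t]]].
have d03 : [disjoint S (i + 3) & S (i + 0)].
  rewrite disjoint_subset; apply/subsetP => b b3; apply/negP => b0.
  by apply: (@square 0 3 [:: b; z; y]) => //; move=> [|[|[|t]]].
have S6 : S (i + 6) = S (i + 4).
  by apply: (third_layer_eq T_card (A := S (i + 3)) (B := S (i + 5)));
    rewrite ?card ?d35 ?d36 ?adj // disjoint_sym adj.
have S0 : S (i + 0) = S (i + 2).
  by apply: (third_layer_eq T_card (A := S (i + 1)) (B := S (i + 3)));
    rewrite ?card ?d13 ?d03 ?adj // disjoint_sym adj.
have d57 : [disjoint S (i + 5) & S (i + 7)] by apply: (alt 4 x); rewrite ?S6.
have S7 : S (i + 7) = S (i + 3).
  apply: (third_layer_eq T_card (A := S (i + 4)) (B := S (i + 5)));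
    rewrite ?card ?d57 ?adj //; try by rewrite disjoint_sym ?adj ?d35.
  by rewrite -S6 adj.
have [b b3] : exists b, b \in S (i + 3).
  apply/set0Pn; rewrite -card_gt0 (card 3 isT).
  exact: ltnW.
apply: (@square 0 4 [:: x; w; x; b]) => //; move=> [|[|[|[|t]]]] //= _;
  by rewrite ?S0 ?S6 ?S7.
Qed.

(** * Words over three classes of colors *)

(** The last [l + m] letters of [w] are those met by the path of
    [folded_square_free]; for [m = l] they form a square. *)
Definition folded_suffix (l m : nat) (w : seq nat) : bool :=
  (l + m <= size w) &&
  all (fun t => nth 0 w (size w - (l + m) + t)
                == nth 0 w (size w - (l + m) + l + fold_back m t)) (iota 0 l).

(** The shapes of three squares and of the words [abcb.abc], [abcacb.abca] and
    [abcabacb.abcab], where the dot marks the middle of the repetition. These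
    few shapes already leave finitely many words over three letters. *)
Definition fold_shapes : seq (nat * nat) :=
  [:: (1, 1); (2, 2); (3, 3); (4, 3); (6, 4); (8, 5)].

Definition folded (w : seq nat) : bool :=
  has (fun lm => folded_suffix lm.1 lm.2 w) fold_shapes.

Definition extensions (ws : seq (seq nat)) : seq (seq nat) :=
  [seq w <- [seq rcons w a | w <- ws, a <- iota 0 3] | ~~ folded w].

Definition unfolded_words (n : nat) : seq (seq nat) :=
  iter n extensions [:: [:: 0; 1]].

(** With its mirror image, up to exchanging the first two letters, one of the two
    words of length twenty that contain no folded square of these shapes. *)
Definition last_word : seq nat :=
  [:: 0; 1; 0; 2; 0; 1; 2; 1; 0; 2; 1; 2; 0; 1; 2; 1; 0; 2; 0; 1].

Definition swap01 (a : nat) : nat := nth 2 [:: 1; 0] a.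

Lemma unfolded_words18 :
  unfolded_words 18 = [:: last_word; map swap01 (rev last_word)].
Proof. by vm_compute. Qed.

Lemma unfolded_words_complete (w : nat -> nat) n :
    (forall i, w i < 3) -> w 0 = 0 -> w 1 = 1 ->
    (forall j, j <= n.+2 -> ~~ folded (mkseq w j)) ->
  mkseq w n.+2 \in unfolded_words n.
Proof.
move=> w_lt3 w0 w1; elim: n => [|n IHn] unfolded.
  by rewrite /mkseq /= w0 w1 inE.
rewrite /unfolded_words iterS mem_filter unfolded // andTb.
rewrite mkseqS; apply: (allpairs_f (@rcons nat)).
  by apply: IHn => j j_le; apply: unfolded; exact: leqW.
by rewrite mem_iota w_lt3.
Qed.

Section ClassWord.

Variables (T : finType) (k : nat).

Definition layer_coloring (S : nat -> {set T}) : Prop :=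
  repetition_free_layers 24 S /\ forall i, i < 24 -> #|S i| = k.

Hypothesis T_card : #|T| <= 3 * k.
Hypothesis k_gt1 : 1 < k.

Lemma layer_coloring_rev S : layer_coloring S ->
  layer_coloring (fun i => S (23 - i)).
Proof.
move=> [S_free S_card]; split; last by move=> i _; apply: S_card; lia.
move=> l pos col l_gt0 inS walk inj rep.
apply: (S_free l (fun t => 23 - pos t) col) => //.
- by move=> t t_lt; have [_ ?] := inS t t_lt; split=> //; lia.
- move=> t t_lt; have := walk t t_lt; have [? _] := inS t.+1 t_lt.
  by have [? _] := inS t (ltnW t_lt); rewrite /adjacent; lia.
- move=> s t s_lt t_lt eq_pos; apply: inj => //.
  by have [? _] := inS s s_lt; have [? _] := inS t t_lt; lia.
Qed.

(** The sets of colors named by the three letters of a word. *)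
Definition class_partition (cls : nat -> {set T}) : Prop :=
  (forall a, a < 3 -> #|cls a| = k) /\
  (forall a b, a < 3 -> b < 3 -> a <> b -> [disjoint cls a & cls b]).

Lemma two_colors (A : {set T}) : #|A| = k ->
  exists x y, [/\ x \in A, y \in A & x <> y].
Proof.
by move=> cA; have /card_gt1P[x [y [? ? /eqP ?]]] : 1 < #|A|;
  [rewrite cA | exists x, y].
Qed.

(** A layer visited twice by the folded half offers a second color of its class;
    this is where [k] is at least two. *)
Lemma class_word_unfolded S cls (w : nat -> nat) i n :
    layer_coloring S -> class_partition cls -> (forall j, w j < 3) ->
    i + n <= 24 -> (forall j, j < n -> S (i + j) = cls (w j)) ->
  ~~ folded (mkseq w n).
Proof.
move=> [S_free S_card] [cls_card _] w_lt3 in_le S_word.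
have /choice[x xP] : forall a, exists x : T, a < 3 -> x \in cls a.
  move=> a; have [a_lt|//] := ltnP a 3; last first.
    have [x _] := two_colors (cls_card 0 isT); by exists x; lia.
  by have [x [_ [? _ _]]] := two_colors (cls_card a a_lt); exists x.
have /choice[y yP] : forall a, exists y, a < 3 -> y \in cls a /\ x a <> y.
  move=> a; have [a_lt|] := ltnP a 3; last by exists (x 0); lia.
  have [z [z' [zin z'in neq]]] := two_colors (cls_card a a_lt).
  have [xz|?] := eqVneq (x a) z; last by exists z => _; split=> //; apply/eqP.
  by exists z' => _; rewrite xz.
apply/hasPn => -[l m] lm_in; apply/negP; rewrite /folded_suffix size_mkseq.
move=> /andP[] /= lm_le /allP letters.
have [m_gt0 ml lm] : [/\ 0 < m, m <= l & l < m.*2].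
  by move: lm_in; rewrite !inE => /or4P[||| /or3P[]] /eqP[-> ->].
have letter_eq t : t < l ->
    w (n - (l + m) + t) = w (n - (l + m) + l + fold_back m t).
  move=> t_lt; have := letters t; rewrite mem_iota t_lt => /(_ isT)/eqP.
  by rewrite !nth_mkseq //; rewrite /fold_back; case: (ltnP t m); lia.
(* The second color [y] is used after the turning point. *)
pose f t := (if t < m then x else y) (w (n - (l + m) + t)).
have f_in t : f t \in cls (w (n - (l + m) + t)).
  by rewrite /f; case: ifP => _; [exact: xP | exact: (yP _ (w_lt3 _)).1].
apply: (@folded_square_free T 24 S S_free (i + (n - (l + m))) l m f) => //.
- by lia.
- by move=> t t_lt; rewrite -addnA S_word ?f_in //; lia.
- move=> t t_lt; rewrite -!addnA S_word; last first.
    by rewrite /fold_back; case: (ltnP t m); lia.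
  by rewrite [n - _ + _]addnA -letter_eq ?f_in.
move=> s t s_lt /andP[t_ge t_lt] fold_t; rewrite /f s_lt ltnNge t_ge /=.
have -> : w (n - (l + m) + t) = w (n - (l + m) + s).
  rewrite letter_eq // fold_t [RHS]letter_eq; last by lia.
  by rewrite /fold_back s_lt.
exact: (yP _ (w_lt3 _)).2.
Qed.

(** Layer 22 avoids class 1, its neighbor, and class 2, which would complete a
    folded square of shape [(6, 4)]; so it is class 0. In the same way shape
    [(4, 3)] makes layer 23 class 1, and layers 20 to 23 read [0101]. *)
Lemma last_word_stuck S cls : layer_coloring S -> class_partition cls ->
    (forall j, j < 20 -> S (2 + j) = cls (nth 0 last_word j)) ->
  False.
Proof.
move=> [S_free S_card] [cls_card cls_disj] S_word.
have [a [a' [aA a'A neq_a]]] := two_colors (cls_card 0 isT).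
have [b [b' [bB b'B neq_b]]] := two_colors (cls_card 1 isT).
have in_word i c : 1 < i < 22 -> c \in cls (nth 0 last_word (i - 2)) -> c \in S i.
  by move=> i_in; rewrite -S_word ?subnKC //; lia.
have disj_adj i : i < 23 -> [disjoint S i & S i.+1].
  by move=> i_lt; apply: (adjacent_layers S_free).
have S21 : S 21 = cls 1 by rewrite (S_word 19).
have S22 : S 22 = cls 0.
  apply: (third_layer_eq T_card (A := cls 1) (B := cls 2)).
  - exact: cls_card.
  - exact: cls_card.
  - exact: cls_card.
  - exact: S_card.
  - exact: cls_disj.
  - exact: cls_disj.
  - exact: cls_disj.
  - by rewrite -S21 disj_adj.
  rewrite disjoint_subset; apply/subsetP => z zC; apply/negP => z22.
  apply: (@folded_square_free T 24 S S_free 13 6 4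
            (nth a [:: z; a; b; z; b'; a'])) => //.
  - by move=> [|[|[|[|[|[|t]]]]]] // _; apply: in_word.
  - by move=> [|[|[|[|[|[|t]]]]]] // _; apply: in_word.
  - by move=> [|[|[|[|s]]]] [|[|[|[|[|[|t]]]]]].
have S23 : S 23 = cls 1.
  apply: (third_layer_eq T_card (A := cls 0) (B := cls 2)).
  - exact: cls_card.
  - exact: cls_card.
  - exact: cls_card.
  - exact: S_card.
  - exact: cls_disj.
  - exact: cls_disj.
  - exact: cls_disj.
  - by rewrite -S22 disj_adj.
  rewrite disjoint_subset; apply/subsetP => z zC; apply/negP => z23.
  apply: (@folded_square_free T 24 S S_free 17 4 3 (nth a [:: b; a; z; a'])) => //.
  - by move=> [|[|[|[|t]]]] // _; apply: in_word.
  - by move=> [|[|[|[|t]]]] // _; rewrite /= ?S22 //; apply: in_word.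
  - by move=> [|[|[|s]]] [|[|[|[|t]]]].
have a20 : a \in S 20 by apply: in_word.
by apply: (meet2_alternate S_free _ a20 _ _ (y := b)); rewrite ?S21 ?S22 ?S23.
Qed.

(** Layers at distance two are equal or disjoint, so layers 2 to 21 all belong to
    three classes and spell a word of length twenty; the search leaves two words,
    and reversing the order of the layers exchanges them. *)
Lemma no_layer_coloring S : ~ layer_coloring S.
Proof.
move=> S_col; have [S_free S_card] := S_col.
have disj_adj i : i < 23 -> [disjoint S i & S i.+1].
  by move=> i_lt; apply: (adjacent_layers S_free).
have layer_eq2 i : 1 < i < 20 -> S i <> S i.+2 -> [disjoint S i & S i.+2].
  move=> i_in neq; rewrite disjoint_subset; apply/subsetP => x x0.
  apply/negP => x2; apply: neq.
  have [i_small|i_large] := leqP i 18.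
    have := @distance2_equal T 24 k S (i - 2) x S_free T_card S_card k_gt1.
    have -> : i - 2 + 2 = i by lia.
    have -> : i - 2 + 4 = i.+2 by lia.
    by apply=> //; lia.
  (* For [i = 19] there are not enough layers to the right: reverse the order. *)
  have [R_free R_card] := layer_coloring_rev S_col.
  have i19 : i = 19 by lia.
  move: x0 x2; rewrite i19 => x0 x2; apply: esym.
  exact: (@distance2_equal T 24 k _ 0 x R_free T_card R_card k_gt1 isT x2 x0).
(* Layers 2 and 4, and layers 3 and 5, cannot both be equal. *)
pose C := if S 4 == S 2 then S 5 else S 4.
pose cls := nth C [:: S 2; S 3].
have d24 : S 4 <> S 2 -> [disjoint S 2 & S 4].
  by move=> /nesym; apply: layer_eq2.
have cls_part : class_partition cls.
  have dAC : [disjoint S 2 & C].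
    rewrite /C; case: eqP => [<-|/d24] //; exact: disj_adj.
  have dBC : [disjoint S 3 & C].
    rewrite /C; case: eqP => [eq42|_]; last exact: disj_adj.
    have [x x2] : exists x, x \in S 2.
      by have [x [_ [? _ _]]] := two_colors (S_card 2 isT); exists x.
    by apply: (alternate_layers S_free (i := 2) _ x2); rewrite ?eq42.
  have cC : #|C| = k by rewrite /C; case: ifP => _; apply: S_card.
  split; first by move=> [|[|[|a]]] // _; apply: S_card.
  have dAB : [disjoint S 2 & S 3] by apply: disj_adj.
  by move=> [|[|[|a]]] [|[|[|b]]] // _ _ _; rewrite /cls /= 1?disjoint_sym.
have [cls_card cls_disj] := cls_part.
have cls_all j : j < 19 -> exists a b, [/\ a < 3, b < 3, a <> b,
    S (2 + j) = cls a & S (3 + j) = cls b].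
  elim: j => [|j IHj] j_lt; first by exists 0, 1.
  have [a [b [a_lt b_lt ab Sa Sb]]] := IHj (ltnW j_lt).
  have [eq2|neq2] := eqVneq (S (2 + j)) (S (4 + j)).
    by exists b, a; split=> //; [exact: nesym | rewrite -Sa eq2].
  exists b, (3 - a - b); split=> //; [lia | lia |].
  have cab : 3 - a - b < 3 by lia.
  apply: (third_layer_eq T_card (A := cls a) (B := cls b));
    rewrite ?cls_card ?S_card //; try (by apply: cls_disj => //; lia); try by lia.
    rewrite -Sa; apply: layer_eq2; [by lia | exact/eqP].
  by rewrite -Sb; apply: disj_adj; lia.
pose w j := if S (2 + j) == cls 0 then 0 else if S (2 + j) == cls 1 then 1 else 2.
have w_lt3 j : w j < 3 by rewrite /w; case: (_ == _) => //; case: (_ == _).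
have S_word j : j < 20 -> S (2 + j) = cls (w j).
  move=> j_lt; have [a a_lt Sa] : exists2 a, a < 3 & S (2 + j) = cls a.
    case: j j_lt => [|j] j_lt; first by exists 0.
    by have [a [b [_ b_lt _ _ Sb]]] := cls_all j j_lt; exists b.
  rewrite /w; case: (_ =P cls 0) => // neq0; case: (_ =P cls 1) => // neq1.
  by case: a a_lt Sa => [|[|[|a]]].
have : mkseq w 20 \in unfolded_words 18.
  apply: unfolded_words_complete => //.
  - by rewrite /w eqxx.
  - rewrite /w eqxx; case: (_ =P cls 0) => // eq32.
    have [x [_ [x2 _ _]]] := two_colors (S_card 2 isT).
    by have := disjointFr (disj_adj 2 isT) x2; rewrite -[S 3]/(S (2 + 1)) eq32 x2.
  move=> j j_le; apply: (class_word_unfolded S_col cls_part w_lt3 (i := 2)); first lia.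
  by move=> i i_lt; apply: S_word; lia.
have nth_w j : j < 20 -> nth 0 (mkseq w 20) j = w j.
  by move=> j_lt; rewrite nth_mkseq.
rewrite unfolded_words18 !inE => /orP[] /eqP w_eq.
  apply: (last_word_stuck S_col cls_part) => j j_lt.
  by rewrite S_word // -nth_w // w_eq.
apply: (last_word_stuck (layer_coloring_rev S_col) (cls := cls \o swap01)).
  split=> [a a_lt|a b a_lt b_lt ab]; first by apply: cls_card; case: a a_lt => [|[|[]]].
  by apply: cls_disj; move: a b a_lt b_lt ab => [|[|[|a]]] [|[|[|b]]].
move=> j j_lt; have -> : 23 - (2 + j) = 2 + (19 - j) by lia.
rewrite S_word ?ltnS ?leq_subr // -nth_w ?ltnS ?leq_subr // w_eq /=.
by do 20 (case: j j_lt => [|j] j_lt //).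
Qed.

End ClassWord.

(** * The color sets of the layers of a coloring *)

Section LayersOfColoring.

Variables (n k m : nat).
Variable c : lex_product (path_graph n) (empty_graph k) -> 'I_m.
Hypothesis c_rainbow : rainbow_nonrepetitive c.
Hypothesis n_ge24 : 24 <= n.

(** The index is a plain number, so that layers can be shifted and reversed
    freely. *)
Definition layer_colors (i : nat) : {set 'I_m} :=
  [set c v | v : lex_product (path_graph n) (empty_graph k) & v.1 == i :> nat].

Lemma layer_colors_coloring : layer_coloring k layer_colors.
Proof.
have [c_nonrep c_inj] := c_rainbow; split; last first.
  move=> i i_lt; pose v : path_graph n := Ordinal (leq_trans i_lt n_ge24).
  have -> : layer_colors i = c @: layer (empty_graph k) v.
    apply/setP => x; apply/imsetP/imsetP => -[[a j]].
      rewrite inE => /eqP a_i ->; exists (a, j) => //.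
      by apply/imsetP; exists j => //; congr (_, _); apply: val_inj.
    by move=> /imsetP[j' _ [-> ->]] ->; exists (v, j'); rewrite ?inE.
  rewrite card_in_imset; last exact: c_inj.
  by rewrite card_imset ?card_ord // => j j' [].
move=> l pos col l_gt0 pos_col walk inj rep.
have /choice[u uP] : forall t, exists v : lex_product (path_graph n) (empty_graph k),
    t < l.*2 -> v.1 = pos t :> nat /\ c v = col t.
  have vertex_at t : t < l.*2 ->
      exists v : lex_product (path_graph n) (empty_graph k),
        v.1 = pos t :> nat /\ c v = col t.
    move=> /pos_col[_ /imsetP[v]]; rewrite inE => /eqP v_pos ->.
    by exists v.
  move=> t; have [/vertex_at[v vP]|t_ge] := ltnP t l.*2; first by exists v.
  by have [v _] := vertex_at 0 ltac:(lia); exists v; lia.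
apply: (c_nonrep (mkseq u l.*2)).
- have [v0 _] : exists v0, v0 = u 0 by exists (u 0).
  apply/(sortedP v0) => t; rewrite size_mkseq => t_lt.
  rewrite !nth_mkseq ?lex_path_edge //; last exact: ltnW.
  by rewrite (uP _ t_lt).1 (uP _ (ltnW t_lt)).1 walk.
- apply/mkseq_uniqP => s t; rewrite !inE => s_lt t_lt eq_u.
  apply: inj => //.
    by rewrite -(uP _ s_lt).1 -(uP _ t_lt).1 eq_u.
  by rewrite -(uP _ s_lt).2 -(uP _ t_lt).2 eq_u.
exists l; split=> //; first by rewrite size_map size_mkseq.
move=> t t_lt; rewrite !onthE -!map_comp !(nth_map 0) ?size_iota; [|lia|lia].
rewrite !nth_iota; [|lia|lia].
rewrite /= !add0n (uP _ _).2; last by lia.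
by rewrite (uP _ _).2 ?(rep t t_lt) //; lia.
Qed.

End LayersOfColoring.

Theorem theorem1p3 (n k : nat) (hn : 24 <= n) (hk : 2 <= k) :
  3 * k + 1 <= rainbow_thue_number (path_graph n) (empty_graph k)
            <= 3 * k + uphalf k.
Proof.
rewrite /rainbow_thue_number; case: ex_minnP => m /asboolP[c c_rainbow] m_min.
rewrite m_min; last exact/asboolP/rainbow_coloring.
rewrite andbT addn1 ltnNge; apply/negP => m_le.
have colors_le : #|'I_m| <= 3 * k by rewrite card_ord.
exact: (no_layer_coloring colors_le hk (layer_colors_coloring c_rainbow hn)).
Qed.
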